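(* Let $\mathcal{K}$ be a geometric simplicial complex in an ambient Euclidean space $\mathbb{E}^J$ and let $\mathcal{L}$ be a subdivision of $\mathcal{K}$. Then $$\bigcup_{\sigma'\in\mathcal{L}}\sigma' \;=\; \bigcup_{\sigma\in\mathcal{K}}\sigma .$$ In particular, their geometric realizations determine the same subset of the ambient space, so $|\mathcal{L}|=|\mathcal{K}|$ as topological spaces with the subspace topology; more generally, there is a canonical homeomorphism $|\mathcal{L}|\cong|\mathcal{K}|$.
   Context: For a set $J$, $\mathbb{E}^J$ (generalized Euclidean space) is the vector space of all $(x_\alpha)_{\alpha\in J}\in\mathbb{R}^J$ with $x_\alpha=0$ for all but finitely many $\alpha$, with the metric $|x-y|=\max_{\alpha\in J}|x_\alpha-y_\alpha|$. A geometric simplicial complex $\mathcal{K}$ in $\mathbb{E}^J$ is a collection of (closed, nonempty) simplices in $\mathbb{E}^J$, closed under taking faces, such that any two simplices of $\mathcal{K}$ intersect either in the empty set or in a common face. $|\mathcal{K}|$ denotes the geometric realization of $\mathcal{K}$; as a subset of the ambient space it is the union of the simplices of $\mathcal{K}$. A geometric simplicial complex $\mathcal{L}$ in $\mathbb{E}^J$ is a subdivision of $\mathcal{K}$ if: (1) for every $\sigma'\in\mathcal{L}$ there is $\sigma\in\mathcal{K}$ with $\sigma'\subset\sigma$; (2) for every $\sigma\in\mathcal{K}$ there are finitely many $\sigma'_1,\dots,\sigma'_n\in\mathcal{L}$ with $\sigma=\bigcup_{i=1}^n\sigma'_i$. *)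

(* Defs.v *)
From HB Require Import structures.
From mathcomp Require Import all_boot all_order all_algebra finmap.
From mathcomp Require Import boolp classical_sets functions cardinality reals.
From mathcomp Require Import topology normedtype.

Set Implicit Arguments.
Unset Strict Implicit.
Unset Printing Implicit Defensive.

Import Order.TTheory GRing.Theory Num.Theory.
Import numFieldNormedType.Exports.

Local Open Scope classical_set_scope.
Local Open Scope ring_scope.

Lemma finite_set_max (R : realDomainType) (A : set R) :
  finite_set A -> A !=set0 -> exists2 y, A y & ubound A y.
Proof.
move=> /finite_seqP[F ->] [x /=]; elim: F x => // a F IH x _.
case: F => [|b F] in IH *.
  by exists a => /=; rewrite ?mem_head// => z /=; rewrite inE => /eqP ->.
have [y yF ub] := IH b (mem_head _ _).
exists (Num.max a y).
  by rewrite /= in_cons; case: leP => _; rewrite ?eqxx// yF orbT.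
move=> z /=; rewrite in_cons le_max => /predU1P[->|zF]; first by rewrite lexx.
by apply/orP; right; exact: ub.
Qed.

(* The set underlying E^J is {x : J -> R | x has finite support}; the index
   set J is an arbitrary type, possibly empty or infinite. *)
Section Euclid.
Context (R : realType) (J : Type).

Definition finsupp : {pred J -> R} :=
  [pred x : J -> R | `[< finite_set [set a | x a != 0] >]].

Lemma finsupp_submod_closed : submod_closed finsupp.
Proof.
split=> [|c x y].
  rewrite inE; apply: (@sub_finite_set _ _ set0) => // a /=.
  by rewrite eqxx.
rewrite !inE => fx fy.
apply: (@sub_finite_set _ _ ([set a | x a != 0] `|` [set a | y a != 0])).
  move=> a /=; case: (eqVneq (x a) 0) => [xa0|xa0] xya; last by left.
  right; apply: contra xya => /eqP ya0.
  have -> : (c *: x + y) a = c * x a + y a by [].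
  by rewrite xa0 ya0 mulr0 addr0.
by rewrite finite_setU.
Qed.

HB.instance Definition _ :=
  GRing.isSubmodClosed.Build R (J -> R) finsupp finsupp_submod_closed.

Record euclid : Type := Euclid { coords : J -> R ; _ : coords \in finsupp }.

HB.instance Definition _ := [isSub of euclid for coords].
HB.instance Definition _ := [Choice of euclid by <:].
HB.instance Definition _ := [SubChoice_isSubLmodule of euclid by <:].

(* The supremum is a maximum, see [euclid_norm_max]; it is 0 if J is empty. *)
Definition euclid_norm (x : euclid) : R := sup (range (fun a => `|coords x a|)).

Lemma euclid_norm_fin (x : euclid) :
  finite_set (range (fun a => `|coords x a|)).
Proof.
case: x => x /= /[!inE] fx.
apply: (@sub_finite_set _ _
  ((fun a => `|x a|) @` [set a | x a != 0] `|` [set 0])).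
  move=> _ [a _ <-]; have [->|xa0] := eqVneq (x a) 0.
    by right; rewrite normr0.
  by left; exists a.
by rewrite finite_setU; split; [exact: finite_image|exact: finite_set1].
Qed.

Lemma euclid_norm_empty (x : euclid) : ~ ([set: J] !=set0) -> euclid_norm x = 0.
Proof.
move=> J0; have r0 : range (fun a => `|coords x a|) = set0.
  by apply/seteqP; split=> y // [a _ _]; case: J0; exists a.
by rewrite /euclid_norm r0 sup0.
Qed.

Lemma euclid_norm_ub (x : euclid) a : `|coords x a| <= euclid_norm x.
Proof.
have A0 : range (fun a => `|coords x a|) !=set0 by exists `|coords x a|, a.
have [y _ yub] := finite_set_max (euclid_norm_fin x) A0.
by apply: ub_le_sup; [exists y|exists a].
Qed.

Lemma euclid_norm_ge0 (x : euclid) : 0 <= euclid_norm x.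
Proof.
have [[a _]|J0] := pselect ([set: J] !=set0).
  exact: le_trans (euclid_norm_ub x a).
by rewrite euclid_norm_empty.
Qed.

Lemma euclid_norm_le (x : euclid) (M : R) :
  0 <= M -> (forall a, `|coords x a| <= M) -> euclid_norm x <= M.
Proof.
move=> M0 xM; have [[a _]|J0] := pselect ([set: J] !=set0).
  by apply: ge_sup; [exists `|coords x a|, a|move=> _ [b _ <-]].
by rewrite euclid_norm_empty.
Qed.

Lemma euclid_norm_max (x : euclid) :
  [set: J] !=set0 -> exists a, euclid_norm x = `|coords x a|.
Proof.
move=> [a0 _].
have [|y [a _ <-{y}] ub] := finite_set_max (euclid_norm_fin x).
  by exists `|coords x a0|, a0.
exists a; apply/eqP; rewrite eq_le euclid_norm_ub andbT.
by apply: euclid_norm_le => // b; apply: ub; exists b.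
Qed.

Lemma euclid_normD (x y : euclid) :
  euclid_norm (x + y) <= euclid_norm x + euclid_norm y.
Proof.
apply: euclid_norm_le => [|a]; first by rewrite addr_ge0 ?euclid_norm_ge0.
by rewrite (le_trans (ler_normD (coords x a) _)) ?lerD ?euclid_norm_ub.
Qed.

Lemma euclid_normZ (c : R) (x : euclid) :
  euclid_norm (c *: x) = `|c| * euclid_norm x.
Proof.
have le d z : euclid_norm (d *: z) <= `|d| * euclid_norm z.
  apply: euclid_norm_le => [|a]; first by rewrite mulr_ge0 ?euclid_norm_ge0.
  rewrite (_ : coords (d *: z) a = d * coords z a)// normrM.
  by rewrite ler_wpM2l ?euclid_norm_ub.
apply/eqP; rewrite eq_le le/=; have [->|c0] := eqVneq c 0.
  by rewrite normr0 mul0r euclid_norm_ge0.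
rewrite -ler_pdivlMl ?normr_gt0// -normfV.
by rewrite -{1}[x](scalerK c0) le.
Qed.

Lemma euclid_norm0_eq0 (x : euclid) : euclid_norm x = 0 -> x = 0.
Proof.
move=> x0; apply: val_inj; apply/funext => a /=.
by apply/eqP; rewrite -normr_le0 -x0 euclid_norm_ub.
Qed.

HB.instance Definition _ := Lmodule_isNormed.Build R euclid
  euclid_normD euclid_normZ euclid_norm0_eq0.

End Euclid.

Section Simplices.
Context (R : realType) (E : lmodType R).
Implicit Types (V W : {fset E}) (s f : set E) (K : set (set E)).

Definition affinely_independent V : Prop :=
  forall c : E -> R, \sum_(v <- V) c v = 0 -> \sum_(v <- V) c v *: v = 0 ->
    forall v, v \in V -> c v = 0.

Definition convex_hull V : set E :=
  [set x | exists t : E -> R, [/\ forall v, v \in V -> 0 <= t v,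
    \sum_(v <- V) t v = 1 & x = \sum_(v <- V) t v *: v]].

Definition spanned_by V s : Prop :=
  [/\ V != fset0, affinely_independent V & s = convex_hull V].

Definition is_simplex s : Prop := exists V, spanned_by V s.

Definition is_face f s : Prop :=
  exists V W, [/\ spanned_by W s, (V `<=` W)%fset & spanned_by V f].

Definition simplicial_complex K : Prop :=
  [/\ forall s, K s -> is_simplex s,
      forall s f, K s -> is_face f s -> K f
    & forall s t, K s -> K t ->
        s `&` t = set0 \/ is_face (s `&` t) s /\ is_face (s `&` t) t].

Definition subdivision L K : Prop :=
  [/\ simplicial_complex L,
      forall s', L s' -> exists2 s, K s & s' `<=` s
    & forall s, K s -> exists2 F : set (set E),
        finite_set F /\ F `<=` L & s = \bigcup_(s' in F) s'].

Definition polyhedron K : set E := \bigcup_(s in K) s.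

End Simplices.

(* [realization K] has the subspace topology of the ambient space, and
   [coherent_realization K] has the same points with the coherent (weak)
   topology: U is open iff, for each simplex s of K, the trace of U on s is
   open in s. The two topologies differ in general when K is infinite. *)
Section Realization.
Context (R : realType) (E : normedModType R).
Implicit Types K : set (set E).

Definition realization K : topologicalType := set_type (polyhedron K).

Definition coherent K : Type := set_type (polyhedron K).

HB.instance Definition _ K := Choice.on (coherent K).

Definition coherent_open K (U : set (coherent K)) : Prop :=
  forall s, K s -> exists2 O : set E, open O &
    forall x : coherent K, s (\val x) -> (U x <-> O (\val x)).

Lemma coherent_openT K : coherent_open [set: coherent K].
Proof. by move=> s Ks; exists setT => //; exact: openT. Qed.

Lemma coherent_openI K : setI_closed (@coherent_open K).
Proof.
move=> U V oU oV s Ks; have [O oO UO] := oU s Ks; have [P oP VP] := oV s Ks.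
exists (O `&` P); first exact: openI.
by move=> x sx; split=> -[/(UO x sx) ? /(VP x sx) ?].
Qed.

Lemma coherent_open_bigU K (I : Type) (f : I -> set (coherent K)) :
  (forall i, coherent_open (f i)) -> coherent_open (\bigcup_i f i).
Proof.
move=> of_ s Ks.
have /choice[O OP] : forall i, exists O : set E, open O /\
    forall x : coherent K, s (\val x) -> (f i x <-> O (\val x)).
  by move=> i; have [O oO fO] := of_ i s Ks; exists O.
exists (\bigcup_i O i); first by apply: bigcup_open => i _; exact: (OP i).1.
by move=> x sx; split=> -[i _ fix_]; exists i => //; apply/((OP i).2 x sx).
Qed.

HB.instance Definition _ K := isOpenTopological.Build (coherent K)
  (@coherent_openT K) (@coherent_openI K) (@coherent_open_bigU K).

Definition coherent_realization K : topologicalType := coherent K.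

End Realization.

Definition homeomorphism (X Y : topologicalType) (f : X -> Y) : Prop :=
  continuous f /\ exists g : Y -> X, [/\ cancel f g, cancel g f & continuous g].

(* Main.v *)
(* Simplices of a normed space are compact, hence closed. A set closed on each
   of the finitely many simplices of L subdividing a simplex s of K is thus
   closed on s, so that the coherent topologies of K and L agree. *)
Require Import Defs.
From mathcomp Require Import all_boot all_order all_algebra finmap.
From mathcomp Require Import boolp classical_sets cardinality reals.
From mathcomp Require Import topology normedtype.

Import Order.TTheory GRing.Theory Num.Theory.
Import numFieldNormedType.Exports.

Local Open Scope ring_scope.
Local Open Scope classical_set_scope.

(** The continuous map [comb] sends the families in the cube [[0,1]^E] whose sum over [V] is 1 onto
    the hull. These families form a closed subset of the cube, which is compact by Tychonoff. *)
Lemma compact_convex_hull (R : realType) (E : normedModType R) (V : {fset E}) :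
  compact (convex_hull V).
Proof.
pose T := prod_topology (fun _ : E => R).
have evalC v : continuous (fun t : T => t v).
  exact: (@proj_continuous E (fun=> R) v).
pose box : set T := [set t | forall v, `[0, 1]%classic (t v)].
pose total (t : T) : R := \sum_(v <- V) t v.
pose comb (t : T) : E := \sum_(v <- V) t v *: v.
have totalC : continuous total.
  by apply: (continuous_big add_continuous) => v _; exact: evalC.
have combC : continuous comb.
  apply: (continuous_big add_continuous) => v _ t.
  exact: (@cvgZr_tmp _ _ _ (nbhs t) _ (fun u : T => u v) _ v (evalC v t)).
have -> : convex_hull V = comb @` (box `&` total @^-1` [set 1]).
  apply/seteqP; split=> [x [t [t0 t1 ->]]|_ [t [tbox t1] <-]]; last first.
    exists t; split=> // v _.
    by have := tbox v; rewrite /= in_itv/= => /andP[].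
  (* [convex_hull] leaves the coefficients outside [V] arbitrary, whereas [box] constrains every
     coordinate, so they are reset to 0. *)
  pose t' : T := fun v => if v \in V then t v else 0.
  have t'E v : v \in V -> t' v = t v by rewrite /t' => ->.
  exists t'; last by apply: eq_big_seq => v /t'E ->.
  split; last by rewrite /= -t1; apply: eq_big_seq.
  move=> v; rewrite /t' /= in_itv/=; case: ifPn => [vV|].
    rewrite t0//= -t1 (big_fsetD1 v)//= lerDl big_seq sumr_ge0// => w.
    by rewrite in_fsetD1 => /andP[_ /t0].
  by rewrite lexx ler01.
apply: continuous_compact; first exact: continuous_subspaceT.
apply: compact_closedI.
  exact: (@tychonoff E (fun=> R) _ (fun=> @segment_compact R 0 1)).
exact: (iffLR (continuous_closedP total) totalC _ (@closed_eq R 1)).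
Qed.

Lemma closed_simplex (R : realType) (E : normedModType R) (s : set E) :
  is_simplex s -> closed s.
Proof.
move=> [V [_ _ ->]].
apply: (@compact_closed E); first exact: norm_hausdorff.
exact: compact_convex_hull.
Qed.

Lemma coherent_realization_openE (R : realType) (E : normedModType R)
    (K : set (set E)) (U : set (coherent_realization K)) :
  open U = coherent_open U.
Proof. by []. Qed.

Section CoherentContinuity.
Context {R : realType} {E : normedModType R} {K L : set (set E)}.

(** An open set of [E] that cuts out the trace of [U] on [s] also cuts out its trace on every [s']
    inside [s]. *)
Lemma coherent_continuous_refines
    (f : coherent_realization L -> coherent_realization K) :
  (forall s', L s' -> exists2 s, K s & s' `<=` s) ->
  (forall x, sval (f x) = sval x) -> continuous f.
Proof.
move=> LK fE; apply/continuousP => U.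
rewrite !coherent_realization_openE => oU s' /LK[s Ks s's].
have [O oO UO] := oU s Ks; exists O => // x /s's; rewrite /= -!fE.
exact: UO.
Qed.

Lemma coherent_continuous_finite_cover
    (g : coherent_realization K -> coherent_realization L) :
  (forall s', L s' -> closed s') ->
  (forall s, K s -> exists2 F : set (set E),
     finite_set F /\ F `<=` L & s = \bigcup_(s' in F) s') ->
  (forall x, sval (g x) = sval x) -> continuous g.
Proof.
move=> Lclosed cover gE; apply/continuousP => U.
rewrite !coherent_realization_openE => oU s /cover[F [finF FL] ->].
(* The choice function is total, so sets outside [L] get the placeholder [set0]. *)
have /choice[O OP] : forall s', exists O : set E, L s' -> open O /\
    forall x : coherent L, s' (\val x) -> (U x <-> O (\val x)).
  move=> s'; have [Ls'|nLs'] := pselect (L s'); last by exists set0.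
  by have [O oO UO] := oU s' Ls'; exists O.
(* Remove from [E] the part of each piece [s'] outside [U]: these parts are closed and finitely
   many. The union of the [O s'] could fail, since [O s'] may meet another piece outside [U]. *)
exists (~` \bigcup_(s' in F) (s' `&` ~` O s')).
  rewrite openC; apply: closed_bigcup => // s' /FL Ls'.
  by apply: closedI; [exact: Lclosed|rewrite closedC; exact: (OP _ Ls').1].
have UO s' (x : coherent_realization K) :
    F s' -> s' (sval x) -> (U (g x) <-> O s' (sval x)).
  by move=> /FL Ls'; rewrite -gE; exact: (OP s' Ls').2.
(* By [UO], a point of [U] lies in [O t] for every piece [t] containing it, so overlaps of pieces do
   no harm. *)
move=> x [s' Fs' s'x]; split=> [Ux [t Ft [tx]]|nC].
  by apply; apply/(UO t x Ft tx).
by apply/(UO s' x Fs' s'x); apply: contrapT => nO; apply: nC; exists s'.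
Qed.

End CoherentContinuity.

Lemma polyhedron_subdivision (R : realType) (E : lmodType R)
    (K L : set (set E)) :
  subdivision L K -> polyhedron L = polyhedron K.
Proof.
move=> [_ LK cover]; apply/seteqP; split=> x [s].
  by move=> /LK[t Kt st] /st tx; exists t.
by move=> /cover[F [_ FL] ->] [t /FL Lt tx]; exists t.
Qed.

(** With [A] and [B] variables the equation can be eliminated, and both maps become the identity. *)
Lemma set_type_eq_bij (T : Type) (A B : set T) : A = B ->
  exists (f : A -> B) (g : B -> A),
    [/\ cancel f g, cancel g f, forall x, sval (f x) = sval x
      & forall y, sval (g y) = sval y].
Proof. by move=> <-; exists id, id. Qed.

Theorem theorem2p2 (R : realType) (J : Type)
    (K L : set (set (euclid R J)))
    (hK : simplicial_complex K) (hL : subdivision L K) :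
  [/\ \bigcup_(s' in L) s' = \bigcup_(s in K) s,
      realization L = realization K,
      exists f : realization L -> realization K,
        homeomorphism f /\ (forall x, sval (f x) = sval x)
    & exists f : coherent_realization L -> coherent_realization K,
        homeomorphism f /\ (forall x, sval (f x) = sval x)].
Proof.
have LK := polyhedron_subdivision _ _ _ _ hL.
have [[Lsimplex _ _] refines cover] := hL.
split.
- exact: LK.
- by rewrite /realization LK.
(* The subspace topology depends only on the underlying set, so replacing [polyhedron K] by a
   variable [B] reduces the claim to the identity map. *)
- have homeo B : polyhedron L = B ->
      exists f : set_type (polyhedron L) -> set_type B,
        homeomorphism f /\ (forall x, sval (f x) = sval x).
    move=> <-; exists id; split=> //.
    by split; [|exists id; split] => // x; exact: cvg_id.
  exact: homeo LK.
(* The coherent topology depends on the complex and not just on its union, so equal unions give only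
   a bijection; continuity is proved separately in each direction. *)
- have [f [g [fK gK fE gE]]] := set_type_eq_bij _ _ _ LK.
  exists f; split=> //; split; first exact: coherent_continuous_refines.
  exists g; split=> //; apply: coherent_continuous_finite_cover => // s' Ls'.
  exact: closed_simplex (Lsimplex _ Ls').
Qed.
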